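(* Let $G$ be a finitely generated non-elementary hyperbolic group, $X$ a finite generating set, and $P$ a positive cone of $G$. Then there do not exist $\lambda\ge1$, $c\ge0$, $r\ge0$ and a $(\lambda,c)$-quasi-geodesic combing of $P$ in $\Gamma(G,X)$ supported on the $r$-neighbourhood of $P$.
   Context: A positive cone of $G$ is a subsemigroup $P$ with $G=P\sqcup P^{-1}\sqcup\{1\}$. A group is non-elementary hyperbolic if it is Gromov hyperbolic and not virtually cyclic. A path in $\Gamma(G,X)$ is a sequence $v_0,\dots,v_k$ of elements with $v_{i+1}$ equal or adjacent to $v_i$; it is a $(\lambda,c)$-quasi-geodesic if $|i-j|/\lambda-c\le d_X(v_i,v_j)$ for all $i,j$. A $(\lambda,c)$-quasi-geodesic combing of $P$ is a set $\mathcal{P}$ of $(\lambda,c)$-quasi-geodesic paths starting at $1_G$ and ending in $P$ such that every $g\in P$ is the endpoint of at least one path of $\mathcal{P}$. It is supported on the $r$-neighbourhood of $P$ if every vertex of every path of $\mathcal{P}$ lies in $\bigcup_{g\in P}\mathbb{B}_X(g,r)$. *)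

(* Defs.v *)
From Stdlib Require Import Reals List ZArith ClassicalEpsilon.
Open Scope R_scope.

Record Group : Type := {
  gcar :> Type;
  gmul : gcar -> gcar -> gcar;
  ginv : gcar -> gcar;
  gone : gcar;
  gmul_assoc : forall a b c, gmul a (gmul b c) = gmul (gmul a b) c;
  gmul_1l : forall a, gmul gone a = a;
  gmul_1r : forall a, gmul a gone = a;
  gmul_Vl : forall a, gmul (ginv a) a = gone;
  gmul_Vr : forall a, gmul a (ginv a) = gone
}.

Arguments gmul {_} _ _.
Arguments ginv {_} _.
Arguments gone {_}.

Section Defs.
Variable G : Group.

Definition letter_val (l : G * bool) : G :=
  if snd l then fst l else ginv (fst l).

Fixpoint word_eval (w : list (G * bool)) : G :=
  match w with
  | nil => gone
  | l :: w' => gmul (letter_val l) (word_eval w')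
  end.

Definition word_over (X : list G) (w : list (G * bool)) : Prop :=
  forall l, In l w -> In (fst l) X.

Definition generates (X : list G) : Prop :=
  forall g : G, exists w, word_over X w /\ word_eval w = g.

Definition is_word_dist (X : list G) (g h : G) (n : nat) : Prop :=
  (exists w, word_over X w /\ length w = n /\ gmul g (word_eval w) = h) /\
  (forall w, word_over X w -> gmul g (word_eval w) = h -> (n <= length w)%nat).

(* The word metric d_X (well defined when X generates G). *)
Definition dX (X : list G) (g h : G) : nat :=
  epsilon (inhabits 0%nat) (fun n => is_word_dist X g h n).

Definition gromov_prod (X : list G) (x y w : G) : R :=
  (INR (dX X x w) + INR (dX X y w) - INR (dX X x y)) / 2.

Definition hyperbolic (X : list G) : Prop :=
  exists delta : R, 0 <= delta /\
    forall x y z w : G,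
      gromov_prod X x z w >= Rmin (gromov_prod X x y w) (gromov_prod X y z w) - delta.

Fixpoint gpow_nat (g : G) (n : nat) : G :=
  match n with O => gone | S n' => gmul g (gpow_nat g n') end.

Definition gpowZ (g : G) (k : Z) : G :=
  match k with
  | Z0 => gone
  | Zpos p => gpow_nat g (Pos.to_nat p)
  | Zneg p => ginv (gpow_nat g (Pos.to_nat p))
  end.

(* G is virtually cyclic: some cyclic subgroup <g> has finite index,
   i.e. G is covered by finitely many left cosets t<g>. *)
Definition virtually_cyclic : Prop :=
  exists (g : G) (T : list G),
    forall h : G, exists t k, In t T /\ h = gmul t (gpowZ g k).

Definition positive_cone (P : G -> Prop) : Prop :=
  (forall a b, P a -> P b -> P (gmul a b)) /\
  (forall g, P g \/ P (ginv g) \/ g = gone) /\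
  (forall g, P g -> ~ P (ginv g)) /\
  ~ P gone /\ ~ P (ginv gone).

Definition eq_or_adj (X : list G) (g h : G) : Prop :=
  h = g \/ exists x, In x X /\ (h = gmul g x \/ h = gmul g (ginv x)).

Definition is_path (X : list G) (v : list G) : Prop :=
  v <> nil /\
  forall i, (S i < length v)%nat -> eq_or_adj X (nth i v gone) (nth (S i) v gone).

Definition quasi_geodesic (X : list G) (lam c : R) (v : list G) : Prop :=
  is_path X v /\
  forall i j, (i < length v)%nat -> (j < length v)%nat ->
    Rabs (INR i - INR j) / lam - c <= INR (dX X (nth i v gone) (nth j v gone)).

Definition qg_combing (X : list G) (lam c : R) (P : G -> Prop)
    (Pc : list G -> Prop) : Prop :=
  (forall v, Pc v ->
     quasi_geodesic X lam c v /\ nth 0 v gone = gone /\ P (last v gone)) /\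
  (forall g, P g -> exists v, Pc v /\ last v gone = g).

Definition supported_on_nbhd (X : list G) (r : R) (P : G -> Prop)
    (Pc : list G -> Prop) : Prop :=
  forall v, Pc v -> forall u, In u v ->
    exists g, P g /\ INR (dX X g u) <= r.

End Defs.

(* Main.v *)
Require Import Defs.
From Stdlib Require Import Reals List.
From Stdlib Require Import ZArith Lia Lra Classical ClassicalEpsilon FinFun.
Open Scope R_scope.

(* If m is the maximum of the ball of radius n for the order x < y <-> x^-1 y in P, then the ball of
   radius n around h = m^-1 contains no positive element, and 1 lies on its boundary.  The paths of
   the combing avoid a slightly smaller ball, so by the Morse lemma no geodesic from 1 to a positive
   element follows [1, h] for longer than a constant C independent of n.  For a generator x, one of
   h x h^-1 and its inverse is positive (or both are 1), whence |h x h^-1| <= C + 1.  By the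
   pigeonhole principle two such h of distinct lengths act in the same way by conjugation on the
   generators; their quotient is a nontrivial central element z, of infinite order since G is
   ordered.  Finally, hyperbolicity bounds the shortest representatives of the cosets of <z>, so G is
   virtually cyclic. *)

(** * Group identities, finiteness principles and powers *)

Section GroupFacts.
Open Scope nat_scope.

Variable G : Group.

Lemma gmul_cancel_l (a b c : G) : gmul a b = gmul a c -> b = c.
Proof.
  intros H. rewrite <- (gmul_1l G b), <- (gmul_1l G c), <- (gmul_Vl G a).
  rewrite <- !gmul_assoc. now rewrite H.
Qed.

Lemma ginv_mulK (a b : G) : gmul (ginv a) (gmul a b) = b.
Proof. now rewrite gmul_assoc, gmul_Vl, gmul_1l. Qed.

Lemma gmul_invK (a b : G) : gmul a (gmul (ginv a) b) = b.
Proof. now rewrite gmul_assoc, gmul_Vr, gmul_1l. Qed.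

Lemma ginv_unique (a b : G) : gmul a b = gone -> ginv a = b.
Proof. intros H. now rewrite <- (ginv_mulK a b), H, gmul_1r. Qed.

Lemma ginvK (a : G) : ginv (ginv a) = a.
Proof. apply ginv_unique, gmul_Vl. Qed.

Lemma ginv_mul (a b : G) : ginv (gmul a b) = gmul (ginv b) (ginv a).
Proof. apply ginv_unique. now rewrite <- gmul_assoc, gmul_invK, gmul_Vr. Qed.

Lemma ginv_1 : ginv (@gone G) = gone.
Proof. apply ginv_unique, gmul_1l. Qed.

Ltac gsimp :=
  repeat (rewrite <- !gmul_assoc || rewrite ginv_mulK || rewrite gmul_invK
    || rewrite ginv_mul || rewrite ginvK || rewrite ginv_1 || rewrite gmul_Vl
    || rewrite gmul_Vr || rewrite gmul_1l || rewrite gmul_1r).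

Lemma nat_least (Q : nat -> Prop) :
  (exists n, Q n) -> exists n, Q n /\ forall m, Q m -> n <= m.
Proof.
  intros H. destruct (Wf_nat.dec_inh_nat_subset_has_unique_least_element Q)
    as (n & [Hn _]); auto using classic.
  now exists n.
Qed.

Lemma pigeonhole (A : Type) (l : list A) (f : nat -> A) :
  (forall n, In (f n) l) -> exists i j, i < j /\ f i = f j.
Proof.
  intros H. apply NNPP. intros C.
  assert (Inj : Injective f).
  { intros i j E. destruct (Nat.lt_trichotomy i j) as [L|[L|L]]; auto;
      exfalso; apply C; [exists i, j|exists j, i]; auto. }
  assert (L := NoDup_incl_length (Injective_map_NoDup Inj (seq_NoDup (S (length l)) 0))
    (l' := l)).
  rewrite length_map, length_seq in L. enough (S (length l) <= length l) by lia.
  apply L. intros a Ha. apply in_map_iff in Ha as (n & <- & _). auto.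
Qed.

Lemma lists_finite (A : Type) (l : list A) (n : nat) :
  exists L, forall w, length w = n -> incl w l -> In w L.
Proof.
  induction n as [|n [L HL]].
  - exists (nil :: nil). intros [|] E; [now left|discriminate].
  - exists (flat_map (fun a => map (cons a) L) l). intros [|a w] E Hw; [discriminate|].
    apply in_flat_map. exists a. split; [apply Hw; now left|].
    apply in_map, HL; [now injection E|]. intros b Hb. apply Hw. now right.
Qed.

Lemma gpow_nat_add (z : G) (a b : nat) :
  gpow_nat G z (a + b) = gmul (gpow_nat G z a) (gpow_nat G z b).
Proof. induction a as [|a IH]; simpl; [now gsimp|now rewrite IH, gmul_assoc]. Qed.

Lemma gpowZ_of_nat (z : G) (n : nat) : gpowZ G z (Z.of_nat n) = gpow_nat G z n.
Proof. destruct n; auto. simpl. now rewrite SuccNat2Pos.id_succ. Qed.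

Lemma gpowZ_opp_of_nat (z : G) (n : nat) :
  gpowZ G z (- Z.of_nat n) = ginv (gpow_nat G z n).
Proof.
  destruct n; simpl; [now rewrite ginv_1|now rewrite SuccNat2Pos.id_succ].
Qed.

Lemma gpowZ_sub (z : G) (a b : nat) :
  gpowZ G z (Z.of_nat a - Z.of_nat b) = gmul (gpow_nat G z a) (ginv (gpow_nat G z b)).
Proof.
  destruct (Nat.le_gt_cases b a) as [L|L].
  - replace (Z.of_nat a - Z.of_nat b)%Z with (Z.of_nat (a - b)) by lia.
    rewrite gpowZ_of_nat. replace a with (a - b + b) at 2 by lia.
    rewrite gpow_nat_add. now gsimp.
  - replace (Z.of_nat a - Z.of_nat b)%Z with (- Z.of_nat (b - a))%Z by lia.
    rewrite gpowZ_opp_of_nat. replace b with (b - a + a) at 2 by lia.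
    rewrite gpow_nat_add. now gsimp.
Qed.

Lemma gpow_nat_central (z : G) : (forall g, gmul z g = gmul g z) ->
  forall n g, gmul (gpow_nat G z n) g = gmul g (gpow_nat G z n).
Proof.
  intros Hz n g. induction n as [|n IH]; simpl; [now gsimp|].
  now rewrite <- gmul_assoc, IH, !gmul_assoc, Hz.
Qed.

Lemma ginv_central (z : G) : (forall g, gmul z g = gmul g z) ->
  forall g, gmul (ginv z) g = gmul g (ginv z).
Proof.
  intros Hz g. apply (gmul_cancel_l z).
  now rewrite gmul_invK, gmul_assoc, Hz, <- gmul_assoc, gmul_Vr, gmul_1r.
Qed.

(** * Exponential against linear growth *)

Lemma pow2_linear_bound (E m : nat) : 2 ^ m < E * (m + 1) -> m <= E * E + E.
Proof.
  intros H. destruct (Nat.le_gt_cases m E) as [|L]; [nia|].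
  replace m with (E + (m - E)) in H at 1 by lia. rewrite Nat.pow_add_r in H.
  assert (A := Nat.pow_gt_lin_r 2 E ltac:(lia)).
  assert (B := Nat.pow_gt_lin_r 2 (m - E) ltac:(lia)).
  assert (C : (E + 1) * (m - E + 1) <= 2 ^ E * 2 ^ (m - E)) by (apply Nat.mul_le_mono; lia).
  nia.
Qed.

(** For the Morse lemma, where a path of length at most [Lam * (6 * n + c)] is halved [m] times.
    With [m = n / D'], either [2 ^ m] is large enough and the premise bounds [n], or
    [2 ^ m < E * (m + 1)] bounds [m], hence [n]. *)
Lemma log_linear_bound (Lam c D : nat) : exists M, forall n,
  (forall m, Lam * (6 * n + c) <= 2 ^ m -> 2 * n <= 1 + (m + 2) * D) -> n <= M.
Proof.
  set (D' := D + 1). set (E := Lam * (6 * D' + c)).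
  exists ((E * E + E + 1) * D' + 1 + 2 * D'). intros n H.
  set (m := n / D'). assert (Hm : D' * m <= n < D' * (m + 1)).
  { assert (A := Nat.div_mod n D' ltac:(lia)).
    assert (B := Nat.mod_upper_bound n D' ltac:(lia)). fold m in A. nia. }
  destruct (Nat.le_gt_cases (Lam * (6 * n + c)) (2 ^ m)) as [A|A].
  - apply H in A. nia.
  - assert (B : m <= E * E + E); [|nia].
    apply pow2_linear_bound. eapply Nat.lt_le_trans; [exact A|].
    unfold E. rewrite <- Nat.mul_assoc. apply Nat.mul_le_mono_l. nia.
Qed.

(** * The word metric *)

Section WordMetric.
Variable X : list G.
Hypothesis Xgen : generates G X.

Notation d := (dX G X).

(** [dX] is picked by [epsilon]; generation supplies the least word length that gives it meaning. *)
Lemma dX_spec (g h : G) : is_word_dist G X g h (d g h).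
Proof.
  unfold dX. apply epsilon_spec.
  destruct (nat_least (fun n => exists w, word_over G X w /\ length w = n
      /\ gmul g (word_eval G w) = h)) as (n & Hn & Hmin).
  - destruct (Xgen (gmul (ginv g) h)) as (w & Hw & E).
    exists (length w), w. rewrite E. gsimp. auto.
  - exists n. split; auto. intros w Hw E. apply Hmin. now exists w.
Qed.

Lemma dX_le_word (g : G) w : word_over G X w -> d g (gmul g (word_eval G w)) <= length w.
Proof. intros Hw. now apply (proj2 (dX_spec _ _)). Qed.

Lemma dX_mul_l (a g h : G) : d (gmul a g) (gmul a h) = d g h.
Proof.
  assert (L : forall a g h : G, d (gmul a g) (gmul a h) <= d g h).
  { clear a g h. intros a g h. destruct (dX_spec g h) as [(w & Hw & <- & E) _].
    rewrite <- E, gmul_assoc. now apply dX_le_word. }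
  apply Nat.le_antisymm; auto.
  rewrite <- (ginv_mulK a g) at 1. rewrite <- (ginv_mulK a h) at 1. apply L.
Qed.

Lemma word_eval_app v w : word_eval G (v ++ w) = gmul (word_eval G v) (word_eval G w).
Proof.
  induction v as [|l v IH]; simpl; [now rewrite gmul_1l|now rewrite IH, gmul_assoc].
Qed.

Lemma dX_tri (x y z : G) : d x z <= d x y + d y z.
Proof.
  destruct (dX_spec x y) as [(v & Hv & <- & E) _].
  destruct (dX_spec y z) as [(w & Hw & <- & F) _].
  rewrite <- F, <- E, <- gmul_assoc, <- word_eval_app, <- length_app.
  apply dX_le_word. intros l Hl. apply in_app_or in Hl as []; auto.
Qed.

Lemma word_inverse w : word_over G X w ->
  exists w', word_over G X w' /\ length w' = length w
    /\ word_eval G w' = ginv (word_eval G w).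
Proof.
  induction w as [|[x b] w IH]; intros Hw; simpl.
  - exists nil. now rewrite ginv_1.
  - destruct IH as (w' & H1 & H2 & H3); [intros l Hl; apply Hw; now right|].
    exists (w' ++ (x, negb b) :: nil). split; [|split].
    + intros l Hl. apply in_app_or in Hl as [Hl|[<-|[]]]; auto.
      apply (Hw (x, b)). now left.
    + rewrite length_app. simpl. lia.
    + rewrite word_eval_app, H3, ginv_mul. f_equal.
      unfold letter_val; simpl. destruct b; simpl; now gsimp.
Qed.

Lemma dX_sym (x y : G) : d x y = d y x.
Proof.
  assert (L : forall x y : G, d y x <= d x y).
  { clear x y. intros x y. destruct (dX_spec x y) as [(w & Hw & <- & E) _].
    destruct (word_inverse w Hw) as (w' & H1 & <- & H3).
    replace x with (gmul y (word_eval G w')) at 1; [now apply dX_le_word|].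
    rewrite H3, <- E. now gsimp. }
  apply Nat.le_antisymm; auto.
Qed.

Lemma dX_refl (x : G) : d x x = 0.
Proof.
  enough (d x x <= 0) by lia. rewrite <- (gmul_1r G x) at 2.
  apply (dX_le_word x nil). intros l [].
Qed.

Lemma dX_1_mul (g h : G) : d gone (gmul (ginv g) h) = d g h.
Proof. now rewrite <- (dX_mul_l g), gmul_1r, gmul_invK. Qed.

Lemma dX_1_inv (g : G) : d gone (ginv g) = d gone g.
Proof. now rewrite <- (dX_mul_l g), gmul_1r, gmul_Vr, dX_sym. Qed.

Lemma dX_generator (g x : G) (b : bool) :
  In x X -> d g (gmul g (if b then x else ginv x)) <= 1.
Proof.
  intros Hx. replace (if b then x else ginv x) with (word_eval G ((x, b) :: nil)).
  - apply dX_le_word. now intros l [<-|[]].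
  - simpl. now rewrite gmul_1r.
Qed.

Lemma dX_adj (g h : G) : eq_or_adj G X g h -> d g h <= 1.
Proof.
  intros [->|(x & Hx & [->| ->])].
  - rewrite dX_refl. lia.
  - now apply (dX_generator g x true).
  - now apply (dX_generator g x false).
Qed.

(** Prefixes of a shortest word trace the geodesic. Subwords bound distances from above; these
    bounds are sharp because they add up to [d x y]. *)
Lemma geodesic_exists (x y : G) : exists p : nat -> G, p 0 = x /\ p (d x y) = y /\
  forall s t, s <= t -> t <= d x y -> d (p s) (p t) = t - s.
Proof.
  destruct (dX_spec x y) as [(w & Hw & Ew & E) _].
  exists (fun t => gmul x (word_eval G (firstn t w))).
  assert (L : forall s t, s <= t ->
    d (gmul x (word_eval G (firstn s w))) (gmul x (word_eval G (firstn t w))) <= t - s).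
  { intros s t Hst. rewrite <- (firstn_skipn s (firstn t w)), firstn_firstn.
    rewrite Nat.min_l by lia. rewrite word_eval_app, gmul_assoc.
    etransitivity; [apply dX_le_word|rewrite length_skipn, length_firstn; lia].
    intros l Hl. apply Hw.
    rewrite <- (firstn_skipn t w). apply in_or_app. left.
    rewrite <- (firstn_skipn s (firstn t w)). apply in_or_app. now right. }
  assert (E0 : gmul x (word_eval G (firstn 0 w)) = x) by (simpl; apply gmul_1r).
  assert (E1 : gmul x (word_eval G (firstn (d x y) w)) = y)
    by now rewrite <- Ew, firstn_all.
  split; [exact E0|split; [exact E1|]]. intros s t Hs Ht.
  assert (A := L 0 s ltac:(lia)). assert (B := L s t Hs). assert (C := L t (d x y) Ht).
  rewrite E0 in A. rewrite E1 in C.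
  assert (T1 := dX_tri x (gmul x (word_eval G (firstn s w))) y).
  assert (T2 := dX_tri (gmul x (word_eval G (firstn s w)))
    (gmul x (word_eval G (firstn t w))) y). lia.
Qed.

Lemma ball_finite (n : nat) : exists l : list G, forall g, d gone g <= n -> In g l.
Proof.
  induction n as [|n [l Hl]].
  - exists (gone :: nil). intros g Hg. left.
    destruct (dX_spec gone g) as [([|? w] & _ & E & F) _]; simpl in *; [|lia].
    now rewrite <- F, gmul_1l.
  - exists (l ++ flat_map (fun x => map (gmul x) l ++ map (gmul (ginv x)) l) X).
    intros g Hg. apply in_or_app.
    destruct (dX_spec gone g) as [([|[x b] w] & Hw & E & F) _];
      rewrite gmul_1l in F; subst g.
    + left. apply Hl. simpl. rewrite dX_refl. lia.
    + right. apply in_flat_map. exists x. split; [apply (Hw (x, b)); now left|].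
      assert (I : In (word_eval G w) l).
      { apply Hl. assert (L := dX_le_word gone w). rewrite gmul_1l in L.
        simpl in *. etransitivity; [apply L|lia]. intros k Hk. apply Hw. now right. }
      apply in_or_app. simpl. unfold letter_val; simpl.
      destruct b; [left|right]; now apply in_map.
Qed.

(** * Hyperbolicity and stability of quasi-geodesics *)

Variable D : nat.
Hypothesis four_point : forall x y z w : G,
  d x z + d y w <= Nat.max (d x y + d z w) (d y z + d x w) + D.

(* The inequality says [2 (u_i | u_(i+k))_q >= B - m D] in Gromov products based at [q]; halving
   the path costs one [D]. *)
Lemma gromov_prod_path (q : G) (u : nat -> G) (B m : nat) : forall i k, k <= 2 ^ m ->
  (forall s, i <= s <= i + k -> B <= 2 * d q (u s)) ->
  (forall s, i <= s < i + k -> d (u s) (u (S s)) + B <= d q (u s) + d q (u (S s))) ->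
  d (u i) (u (i + k)) + B <= d q (u i) + d q (u (i + k)) + m * D.
Proof.
  induction m as [|m IH]; intros i k Hk H1 H2.
  - simpl in Hk. destruct k as [|[|k]]; [| |lia].
    + rewrite Nat.add_0_r, dX_refl. specialize (H1 i ltac:(lia)). lia.
    + rewrite Nat.add_1_r. specialize (H2 i ltac:(lia)). lia.
  (* If [k <= 2 ^ m], the second half is a single point, a case settled by [H1]. *)
  - simpl in Hk. set (k1 := Nat.min k (2 ^ m)).
    assert (I1 := IH i k1 ltac:(lia)). assert (I2 := IH (i + k1) (k - k1) ltac:(lia)).
    replace (i + k1 + (k - k1)) with (i + k) in I2 by lia.
    assert (F := four_point (u i) (u (i + k1)) (u (i + k)) q).
    rewrite (dX_sym (u i) q), (dX_sym (u (i + k)) q), (dX_sym (u (i + k1)) q) in F.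
    lapply I1; [|intros; apply H1; lia]. lapply I2; [|intros; apply H1; lia].
    clear I1 I2. intros I2 I1.
    lapply I1; [|intros; apply H2; lia]. lapply I2; [|intros; apply H2; lia].
    lia.
Qed.

(* At a geodesic point [q] farthest from the path, at distance [n], the geodesic points at distance
   [2n] on both sides of [q] are joined by a path of length linear in [n] that stays [n]-far from
   [q]; by [gromov_prod_path] this forces [n] to be at most logarithmic in [n]. *)
Lemma morse (Lam c : nat) : exists M, forall (N : nat) (v : nat -> G),
  (forall i, i < N -> d (v i) (v (S i)) <= 1) ->
  (forall i j, i <= j <= N -> j - i <= Lam * (d (v i) (v j) + c)) ->
  forall p, p 0 = v 0 -> p (d (v 0) (v N)) = v N ->
  (forall s t, s <= t -> t <= d (v 0) (v N) -> d (p s) (p t) = t - s) ->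
  forall t, t <= d (v 0) (v N) -> exists i, i <= N /\ d (p t) (v i) <= M.
Proof.
  destruct (log_linear_bound Lam c D) as [M HM]. exists M.
  intros N v Hstep Hqg p p0 pL Hp. set (L := d (v 0) (v N)) in *.
  destruct (nat_least (fun n => forall t, t <= L -> exists i, i <= N /\ d (p t) (v i) <= n))
    as (n & Hn & Hmin).
  { exists L. intros t Ht. exists 0. split; [lia|].
    rewrite <- p0, dX_sym, Hp; lia. }
  enough (n <= M).
  { intros t Ht. destruct (Hn t Ht) as (i & Hi & H'). exists i. lia. }
  assert (Far : exists t, t <= L /\ forall i, i <= N -> n <= d (p t) (v i)).
  { apply NNPP. intros C.
    destruct n as [|n]; [apply C; exists 0; split; intros; lia|].
    enough (S n <= n) by lia. apply Hmin. intros t Ht. apply NNPP. intros C'.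
    apply C. exists t. split; auto. intros i Hi.
    destruct (Nat.le_gt_cases (S n) (d (p t) (v i))); auto.
    exfalso. apply C'. exists i. lia. }
  destruct Far as (t & Ht & Far). apply HM. intros m Hm.
  (* Truncation stops [a] and [b] at the ends of the geodesic, which lie on the path. *)
  set (a := p (t - 2 * n)). set (b := p (Nat.min L (t + 2 * n))).
  (* The last inequality says that the Gromov product [(a | v i)] based at [p t] is at least [n]. *)
  assert (A : exists i, i <= N /\ d a (v i) <= n /\ d a (p t) <= 2 * n
      /\ 2 * n + d a (v i) <= d (p t) (v i) + d a (p t)).
  { unfold a. rewrite (Hp (t - 2 * n) t) by lia.
    destruct (Nat.le_gt_cases (2 * n) t) as [T|T].
    - destruct (Hn (t - 2 * n) ltac:(lia)) as (i & Hi & H).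
      exists i. specialize (Far i Hi). lia.
    - exists 0. replace (t - 2 * n) with 0 by lia. specialize (Far 0 ltac:(lia)).
      rewrite <- p0 in *. rewrite dX_refl.
      rewrite (dX_sym (p t)), (Hp 0 t) in * by lia. lia. }
  assert (B : exists j, j <= N /\ d b (v j) <= n /\ d (p t) b <= 2 * n
      /\ 2 * n + d b (v j) <= d (p t) (v j) + d (p t) b).
  { unfold b. rewrite (Hp t (Nat.min L (t + 2 * n))) by lia.
    destruct (Nat.le_gt_cases (t + 2 * n) L) as [T|T].
    - destruct (Hn (t + 2 * n) ltac:(lia)) as (j & Hj & H).
      exists j. specialize (Far j Hj). rewrite Nat.min_r by lia. lia.
    - exists N. rewrite Nat.min_l by lia. specialize (Far N ltac:(lia)).
      rewrite <- pL in *. rewrite dX_refl. rewrite (Hp t L) in * by lia. lia. }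
  destruct A as (i & Hi & A1 & A2 & A3). destruct B as (j & Hj & B1 & B2 & B3).
  assert (E : d a b = d a (p t) + d (p t) b).
  { unfold a, b. rewrite !Hp by lia. lia. }
  assert (K : d (v i) (v j) + 2 * n <= d (p t) (v i) + d (p t) (v j) + 1 + m * D).
  (* [6 * n] is [n + 4 * n + n], going through [a] and [b]. The two vertices may occur on the path
     in either order. *)
  { assert (W : forall i j, i <= j <= N -> d (v i) (v j) <= 6 * n ->
      d (v i) (v j) + 2 * n <= d (p t) (v i) + d (p t) (v j) + 1 + m * D).
    { clear i j Hi A1 A3 Hj B1 B3. intros i j Hij Hd.
      (* Successive vertices are at least [n] from [p t] and at most 1 apart, whence [2 * n - 1]. *)
      assert (G1 := gromov_prod_path (p t) v (2 * n - 1) m i (j - i)).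
      replace (i + (j - i)) with j in G1 by lia.
      lapply G1; [clear G1; intros G1|etransitivity; [exact (Hqg i j Hij)|];
        etransitivity; [|exact Hm]; apply Nat.mul_le_mono_l; lia].
      lapply G1; [clear G1; intros G1|intros s Hs; specialize (Far s ltac:(lia)); lia].
      lapply G1; [lia|]. intros s Hs. assert (F1 := Far s ltac:(lia)).
      assert (F2 := Far (S s) ltac:(lia)). specialize (Hstep s ltac:(lia)).
      assert (T := dX_tri (v s) (p t) (v (S s))). rewrite (dX_sym (v s) (p t)) in T. lia. }
    assert (T1 := dX_tri (v i) a (v j)). assert (T2 := dX_tri a b (v j)).
    rewrite (dX_sym (v i) a) in T1.
    destruct (Nat.le_gt_cases i j).
    - apply W; lia.
    - rewrite dX_sym, (Nat.add_comm (d (p t) (v i))). apply W; [lia|].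
      rewrite dX_sym. lia. }
  (* Chaining [(a | v i)], [(v i | v j)] and [(v j | b)] costs [D] twice, while [(a | b) = 0]
     because [p t] lies between [a] and [b]. *)
  assert (F1 := four_point a (v i) b (p t)).
  assert (F2 := four_point (v i) (v j) b (p t)).
  rewrite (dX_sym b (p t)), (dX_sym (v i) (p t)), (dX_sym (v j) b),
    (dX_sym (v j) (p t)) in *.
  lia.
Qed.

(** * Positive cones and balls that avoid them *)

Variable P : G -> Prop.
Hypothesis HP : positive_cone G P.

Lemma cone_irrefl (g : G) : P g -> P (ginv g) -> False.
Proof. intros H. now apply (proj1 (proj2 (proj2 HP))). Qed.

Lemma cone_1 : ~ P gone.
Proof. apply HP. Qed.

Lemma cone_mul (a b : G) : P a -> P b -> P (gmul a b).
Proof. apply HP. Qed.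

Lemma cone_cases (g : G) : P g \/ P (ginv g) \/ g = gone.
Proof. apply HP. Qed.

(** In the order where [f < m] means that [f^-1 m] is positive, the maximum of the elements of [Q]
    other than the head [a] is compared with [a]. *)
Lemma finite_set_max (l : list G) : forall Q : G -> Prop,
  (forall f, Q f -> In f l) -> (exists f, Q f) ->
  exists m, Q m /\ forall f, Q f -> f = m \/ P (gmul (ginv f) m).
Proof.
  induction l as [|a l IH]; intros Q HQ [f0 Hf0]; [now apply HQ in Hf0|].
  destruct (classic (exists f, Q f /\ f <> a)) as [HE|HE].
  - destruct (IH (fun f => Q f /\ f <> a)) as (m & [Hm Hma] & Hmax); auto.
    { intros f [Hf Hfa]. destruct (HQ f Hf) as [->|]; easy. }
    destruct (classic (Q a /\ P (gmul (ginv m) a))) as [[Ha Pa]|C].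
    + exists a. split; auto. intros f Hf.
      destruct (classic (f = a)) as [|Hfa]; auto. right.
      destruct (Hmax f) as [->|Pf]; auto.
      replace (gmul (ginv f) a) with (gmul (gmul (ginv f) m) (gmul (ginv m) a))
        by now gsimp.
      now apply cone_mul.
    + exists m. split; auto. intros f Hf.
      destruct (classic (f = a)) as [->|Hfa]; auto. right.
      destruct (cone_cases (gmul (ginv a) m)) as [|[Pa|E]]; auto.
      * exfalso. apply C. split; auto. revert Pa. now gsimp.
      * exfalso. apply Hma. rewrite <- (gmul_1r G a), <- E. now gsimp.
  - exists a. assert (U : forall f, Q f -> f = a).
    { intros f Hf. apply NNPP. eauto. }
    split; auto. now rewrite <- (U f0 Hf0).
Qed.

Lemma generator_nontrivial : ~ virtually_cyclic G -> exists x, In x X /\ x <> gone.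
Proof.
  intros HV. apply NNPP. intros C. apply HV. exists gone, (gone :: nil). intros h.
  exists gone, 0%Z. split; [now left|]. simpl. rewrite gmul_1l.
  destruct (Xgen h) as (w & Hw & <-). induction w as [|[x b] w IH]; auto.
  simpl. rewrite IH by (intros l Hl; apply Hw; now right).
  assert (E : x = gone).
  { apply NNPP. intros N. apply C. exists x. split; auto. apply (Hw (x, b)). now left. }
  unfold letter_val; simpl. rewrite E. destruct b; now gsimp.
Qed.

(** Take [h = m^-1] with [m] the maximum of the ball around 1. If [m] were shorter than [n], a
    positive generator or inverse generator [s] would give [m s > m] in the ball. A positive [g]
    within [n] of [h] would do the same with [m g]. *)
Lemma ball_disjoint_cone (n : nat) : ~ virtually_cyclic G ->
  exists h, d gone h = n /\ forall g, d h g <= n -> ~ P g.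
Proof.
  intros HV. destruct (generator_nontrivial HV) as (x & Hx & Nx).
  destruct (ball_finite n) as [l Hl].
  destruct (finite_set_max l (fun f => d gone f <= n) Hl) as (m & Hm & Hmax).
  { exists gone. rewrite dX_refl. lia. }
  exists (ginv m). rewrite dX_1_inv. split.
  - apply Nat.le_antisymm; auto. apply Nat.le_ngt. intros L.
    assert (S : exists b : bool, P (if b then x else ginv x)).
    { destruct (cone_cases x) as [|[|]]; [now exists true|now exists false|easy]. }
    destruct S as [b Ps]. assert (A := dX_generator m x b Hx).
    set (s := if b then x else ginv x) in *.
    destruct (Hmax (gmul m s)) as [E|E].
    + assert (T := dX_tri gone m (gmul m s)). lia.
    + apply cone_1. replace (@gone G) with s; auto.
      apply (gmul_cancel_l m). now rewrite E, gmul_1r.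
    + apply (cone_irrefl s); auto. revert E. gsimp. auto.
  - intros g Hg Pg. rewrite <- dX_1_mul, ginvK in Hg.
    destruct (Hmax _ Hg) as [E|E].
    + apply cone_1. replace (@gone G) with g; auto.
      apply (gmul_cancel_l m). now rewrite E, gmul_1r.
    + apply (cone_irrefl g); auto. revert E. gsimp. auto.
Qed.

(** * From the combing to a central element *)

Variables Lam c r : nat.
Hypothesis combing : forall y, P y -> exists (N : nat) (v : nat -> G),
  v 0 = gone /\ v N = y /\
  (forall i, i < N -> d (v i) (v (S i)) <= 1) /\
  (forall i j, i <= j <= N -> j - i <= Lam * (d (v i) (v j) + c)) /\
  (forall i, i <= N -> exists g, P g /\ d g (v i) <= r).

(* The conclusion bounds the Gromov product [(h | y)_1] independently of [h]. *)
Lemma shadow_disjoint_cone : exists C, forall h,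
  (forall g, d h g <= d gone h -> ~ P g) ->
  forall y, P y -> d gone h + d gone y <= d h y + C.
Proof.
  destruct (morse Lam c) as [M HM]. exists (2 * (D + M + r) + 2). intros h Hh y Py.
  destruct (combing y Py) as (N & v & v0 & vN & Hstep & Hqg & Hsup).
  destruct (geodesic_exists gone y) as (p & p0 & pL & Hp).
  assert (T1 := dX_tri gone h y). assert (T2 := dX_tri gone y h).
  assert (T3 := dX_tri h gone y). rewrite (dX_sym y h) in T2.
  rewrite (dX_sym h gone) in T3.
  (* The Gromov product [(h | y)] at 1, rounded down. *)
  set (t := (d gone h + d gone y - d h y) / 2).
  assert (Ht : 2 * t <= d gone h + d gone y - d h y < 2 * t + 2).
  { unfold t. split; [apply Nat.Div0.mul_div_le|].
    assert (A := Nat.mul_succ_div_gt (d gone h + d gone y - d h y) 2). lia. }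
  destruct (HM N v Hstep Hqg p) with (t := t) as (i & Hi & Hd);
    rewrite ?v0, ?vN in *; auto; [lia|].
  destruct (Hsup i Hi) as (g & Pg & Hg).
  assert (A := Hp 0 t). assert (B := Hp t (d gone y)). rewrite p0 in A. rewrite pL in B.
  (* This yields [d h (p t) + t <= d gone h + D]. Once [t >= D + M + r], the positive [g] falls into
     the ball around [h], which explains the constant. *)
  assert (F := four_point (p t) gone h y). rewrite (dX_sym (p t) gone) in F.
  apply Nat.le_ngt. intros L. apply (Hh g); auto.
  assert (S1 := dX_tri h (p t) g). assert (S2 := dX_tri (p t) (v i) g).
  rewrite (dX_sym h (p t)) in S1. rewrite (dX_sym g (v i)) in Hg. lia.
Qed.

Lemma central_exists : ~ virtually_cyclic G ->
  exists z : G, z <> gone /\ forall g, gmul z g = gmul g z.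
Proof.
  intros HV. destruct shadow_disjoint_cone as [C HC].
  assert (H : forall n, exists h, d gone h = n /\
    forall x, In x X -> d gone (gmul h (gmul x (ginv h))) <= C + 1).
  { intros n. destruct (ball_disjoint_cone n HV) as (h & Hn & Hh). exists h. split; auto.
    intros x Hx. rewrite <- Hn in Hh. specialize (HC h Hh).
    assert (L : forall b : bool,
      P (gmul h (gmul (if b then x else ginv x) (ginv h))) ->
      d gone (gmul h (gmul (if b then x else ginv x) (ginv h))) <= C + 1).
    { intros b Hb. apply HC in Hb.
      assert (A := dX_generator gone x b Hx). rewrite gmul_1l in A.
      set (s := if b then x else ginv x) in *.
      (* For [y = h s h^-1] this gives [d h y <= 1 + |h|], so the bound on the product becomes
         [|y| <= C + 1]. *)
      assert (E : d h (gmul h (gmul s (ginv h))) = d gone (gmul s (ginv h)))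
        by now rewrite <- dX_1_mul, ginv_mulK.
      assert (T := dX_tri gone s (gmul s (ginv h))).
      rewrite <- (dX_1_mul s), ginv_mulK, dX_1_inv in T. lia. }
    destruct (cone_cases (gmul h (gmul x (ginv h)))) as [Py|[Py|E]].
    - now apply (L true).
    - rewrite <- dX_1_inv. revert Py. gsimp. apply (L false).
    - rewrite E, dX_refl. lia. }
  set (h := fun n => proj1_sig (constructive_indefinite_description _ (H n))).
  assert (Hh := fun n => proj2_sig (constructive_indefinite_description _ (H n))).
  change (forall n, d gone (h n) = n /\
    forall x, In x X -> d gone (gmul (h n) (gmul x (ginv (h n)))) <= C + 1) in Hh.
  clearbody h.
  destruct (ball_finite (C + 1)) as [l Hl].
  destruct (lists_finite G l (length X)) as [LL HLL].
  destruct (pigeonhole _ LL (fun n => map (fun x => gmul (h n) (gmul x (ginv (h n)))) X))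
    as (i & j & Hij & E).
  { intros n. apply HLL; [apply length_map|]. intros a Ha.
    apply in_map_iff in Ha as (x & <- & Hx). now apply Hl, Hh. }
  exists (gmul (ginv (h i)) (h j)). split.
  { intros E1. assert (E2 : h j = h i).
    { apply (gmul_cancel_l (ginv (h i))). now rewrite E1, gmul_Vl. }
    assert (A := proj1 (Hh i)). rewrite <- E2, (proj1 (Hh j)) in A. lia. }
  set (z := gmul (ginv (h i)) (h j)).
  assert (Cx : forall x, In x X -> gmul z x = gmul x z).
  { intros x Hx. rewrite map_ext_in_iff in E. specialize (E x Hx). simpl in E.
    unfold z. apply (gmul_cancel_l (h i)). gsimp.
    apply (f_equal (fun a => gmul a (h j))) in E. revert E. gsimp. auto. }
  assert (Ci : forall x, In x X -> gmul z (ginv x) = gmul (ginv x) z).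
  { intros x Hx. apply (gmul_cancel_l x). rewrite gmul_invK, gmul_assoc, <- Cx by auto.
    now gsimp. }
  intros g. destruct (Xgen g) as (w & Hw & <-). clear E.
  induction w as [|[x b] w IH]; simpl; [now gsimp|].
  assert (Hx : In x X) by (apply (Hw (x, b)); now left).
  rewrite <- gmul_assoc, <- IH by (intros l' Hl'; apply Hw; now right).
  rewrite !gmul_assoc. f_equal. unfold letter_val; simpl. destruct b; auto.
Qed.

(** * Positive central elements and virtual cyclicity *)

Lemma central_cone_exists : ~ virtually_cyclic G ->
  exists z, P z /\ forall g, gmul z g = gmul g z.
Proof.
  intros HV. destruct (central_exists HV) as (z & Nz & Cz).
  destruct (cone_cases z) as [|[|]]; [now exists z| |easy].
  exists (ginv z). split; auto using ginv_central.
Qed.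

(** If the powers stayed in a ball, two would coincide, and a power of [z] with positive exponent,
    which is positive, would be trivial. *)
Lemma cone_powers_unbounded (z : G) : P z ->
  forall n, exists k, n <= d gone (gpow_nat G z k).
Proof.
  intros Pz n. apply NNPP. intros C. destruct (ball_finite n) as [l Hl].
  destruct (pigeonhole _ l (gpow_nat G z)) as (i & j & Hij & E).
  { intros k. apply Hl. destruct (Nat.le_gt_cases (d gone (gpow_nat G z k)) n); auto.
    exfalso. apply C. exists k. lia. }
  assert (Pp : forall k, P (gpow_nat G z (S k))).
  { induction k; [simpl; now rewrite gmul_1r|]. simpl in *. now apply cone_mul. }
  apply cone_1. replace (@gone G) with (gpow_nat G z (S (j - i - 1))); auto.
  apply (gmul_cancel_l (gpow_nat G z i)). rewrite <- gpow_nat_add, gmul_1r, E.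
  f_equal. lia.
Qed.

(* With [w] a power of [z] barely longer than [g], minimality of [g] in its coset makes the products
   of [g] with [w] and [w^-1] large, so [w] and [w^-1] fellow-travel for half of their length and [w]
   almost fixes the midpoint [m] of [1, w]; but [w] moves [m] by the length of [w]. *)
Lemma coset_minimal_short (z g : G) : P z -> (forall a, gmul z a = gmul a z) ->
  (forall k, d gone g <= d gone (gmul g (gpow_nat G z k))
    /\ d gone g <= d gone (gmul g (ginv (gpow_nat G z k)))) ->
  d gone g <= 2 + 6 * D + 2 * d gone z.
Proof.
  intros Pz Cz Hmin. set (l := d gone g). set (a := d gone z).
  destruct (nat_least _ (cone_powers_unbounded z Pz (l + D))) as (k & Hk & Hleast).
  set (w := gpow_nat G z k) in *.
  assert (Cw : forall b, gmul w b = gmul b w) by now apply gpow_nat_central.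
  assert (Ci : forall b, gmul (ginv w) b = gmul b (ginv w)) by now apply ginv_central.
  assert (Hw : d gone w <= l + D + a).
  { destruct k as [|k]; [unfold w; simpl; rewrite dX_refl; lia|].
    destruct (Nat.le_gt_cases (l + D) (d gone (gpow_nat G z k))) as [A|A].
    - apply Hleast in A. lia.
    - unfold w; simpl. assert (T := dX_tri gone z (gmul z (gpow_nat G z k))).
      rewrite <- (dX_1_mul z), ginv_mulK in T. lia. }
  destruct (Hmin k) as [M1 M2]. fold w l in M1, M2.
  assert (E1 : d (gmul g w) w = l) by now rewrite <- Cw, dX_sym, <- dX_1_mul, ginv_mulK.
  assert (E2 : d g (gmul g w) = d gone w) by now rewrite <- dX_1_mul, ginv_mulK.
  assert (E3 : d g w = d gone (gmul g (ginv w)))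
    by now rewrite dX_sym, <- dX_1_mul, Ci.
  assert (E4 : d (ginv w) g = d gone (gmul g w)) by now rewrite <- dX_1_mul, ginvK, Cw.
  (* [F1] gives [|g w| + |g w^-1| <= 2 |w| + D]. Both terms are at least [l], so neither exceeds
     [2 |w| + D - l], and [F2] bounds [d w w^-1] by [|w| + 4 D + 2 |z|]. *)
  assert (F1 := four_point gone g (gmul g w) w).
  rewrite E1, E2 in F1. fold l in F1.
  assert (F2 := four_point w gone (ginv w) g).
  rewrite (dX_sym w gone), (dX_sym w g), dX_1_inv, E4 in F2.
  destruct (geodesic_exists gone w) as (p & p0 & pL & Hp).
  set (s := d gone w / 2).
  assert (Hs : 2 * s <= d gone w < 2 * s + 2).
  { unfold s. split; [apply Nat.Div0.mul_div_le|].
    assert (A := Nat.mul_succ_div_gt (d gone w) 2). lia. }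
  set (m := p s).
  assert (A := Hp 0 s). assert (B := Hp s (d gone w)). rewrite p0 in A. rewrite pL in B.
  (* The midpoint of the translated geodesic from [w^-1] to 1; centrality gives [d m m' = |w|]. *)
  fold m in A, B. set (m' := gmul (ginv w) m).
  assert (E5 : d m m' = d gone w).
  { unfold m'. now rewrite Ci, <- dX_1_mul, ginv_mulK, dX_1_inv. }
  assert (E6 : d gone m' = d m w).
  { unfold m'. now rewrite dX_1_mul, dX_sym. }
  assert (E7 : d m' (ginv w) = d gone m).
  { unfold m'. rewrite <- (gmul_1r G (ginv w)) at 2. now rewrite dX_mul_l, dX_sym. }
  (* [F3] bounds [d m w^-1] by about [|w| / 2]; then [F4] bounds [d m m' = |w|], and with it [l]. *)
  assert (F3 := four_point m gone (ginv w) w).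
  rewrite (dX_sym m gone), (dX_sym (ginv w) w), dX_1_inv in F3.
  assert (F4 := four_point m gone m' (ginv w)).
  rewrite (dX_sym m gone), E7, E6, E5, dX_1_inv in F4.
  lia.
Qed.

(** Shortest coset representatives lie in a fixed finite ball. Exponents are differences of
    naturals, so multiplying by [z^k] or [z^-k] keeps the form [f a b]. *)
Lemma central_cone_virtually_cyclic (z : G) :
  P z -> (forall a, gmul z a = gmul a z) -> virtually_cyclic G.
Proof.
  intros Pz Cz. destruct (ball_finite (2 + 6 * D + 2 * d gone z)) as [l Hl].
  exists z, l. intros g.
  assert (Cp := gpow_nat_central z Cz).
  set (f := fun a b => gmul (gpow_nat G z a) (ginv (gpow_nat G z b))).
  destruct (nat_least (fun n => exists a b, d gone (gmul g (f a b)) = n))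
    as (n & (a & b & <-) & Hmin); [exists (d gone (gmul g (f 0 0))), 0, 0; auto|].
  exists (gmul g (f a b)), (Z.of_nat b - Z.of_nat a)%Z. split.
  - apply Hl. apply coset_minimal_short with (z := z); auto. intros k.
    split; apply Hmin; [exists (a + k), b|exists a, (b + k)]; unfold f;
      rewrite gpow_nat_add; gsimp; do 3 f_equal.
    + apply Cp.
    + apply ginv_central. apply Cp.
  - rewrite gpowZ_sub. unfold f. gsimp. reflexivity.
Qed.

End WordMetric.
End GroupFacts.

(** * From real to natural constants, and conclusion *)

Lemma INR_upper (x : R) : exists n : nat, x <= INR n.
Proof. destruct (INR_unbounded x) as [n Hn]. exists n. lra. Qed.

(** Subtracting the three distances to [w] from the doubled products turns the minimum into a
    maximum; [D] is at least [2 * delta]. *)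
Lemma hyperbolic_four_point (G : Group) (X : list G) : hyperbolic G X ->
  exists D : nat, forall x y z w : G, (dX G X x z + dX G X y w
    <= Nat.max (dX G X x y + dX G X z w) (dX G X y z + dX G X x w) + D)%nat.
Proof.
  intros (delta & _ & H). destruct (INR_upper (2 * delta)) as [D HD].
  exists D. intros x y z w. specialize (H x y z w). unfold gromov_prod in H.
  assert (A : (dX G X x z + dX G X y w <= dX G X x y + dX G X z w + D \/
    dX G X x z + dX G X y w <= dX G X y z + dX G X x w + D)%nat); [|lia].
  unfold Rmin in H. destruct (Rle_dec _ _) in H; [left|right];
    apply INR_le; rewrite !plus_INR; lra.
Qed.

Lemma last_nth_pred (A : Type) (v : list A) (a : A) :
  last v a = nth (length v - 1) v a.
Proof.
  induction v as [|b [|b' v] IH]; auto.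
  change (last (b :: b' :: v) a) with (last (b' :: v) a). rewrite IH. simpl.
  now rewrite Nat.sub_0_r.
Qed.

Lemma quasi_geodesic_nat (G : Group) (X : list G) (lam c : R) (L C : nat) (v : list G) :
  1 <= lam -> 0 <= c -> lam <= INR L -> c <= INR C -> quasi_geodesic G X lam c v ->
  forall i j, (i <= j < length v)%nat ->
  (j - i <= L * (dX G X (nth i v gone) (nth j v gone) + C))%nat.
Proof.
  intros Hl Hc HL HC [_ H] i j Hij. specialize (H i j ltac:(lia) ltac:(lia)).
  apply INR_le. rewrite minus_INR, mult_INR, plus_INR by lia.
  set (n := INR (dX G X (nth i v gone) (nth j v gone))) in *.
  assert (Hn : 0 <= n) by apply pos_INR.
  assert (A : INR j - INR i <= lam * (n + c)).
  { rewrite Rabs_minus_sym in H. assert (B := Rle_abs (INR j - INR i)).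
    assert (E : Rabs (INR j - INR i) = lam * (Rabs (INR j - INR i) / lam)) by (field; lra).
    rewrite E in B. etransitivity; [exact B|]. apply Rmult_le_compat_l; lra. }
  etransitivity; [exact A|]. apply Rmult_le_compat; lra.
Qed.

Theorem theorem3p5 (G : Group) (X : list G) (P : G -> Prop) :
  generates G X ->
  hyperbolic G X ->
  ~ virtually_cyclic G ->
  positive_cone G P ->
  ~ (exists (lam c r : R) (Pc : list G -> Prop),
       1 <= lam /\ 0 <= c /\ 0 <= r /\
       qg_combing G X lam c P Pc /\ supported_on_nbhd G X r P Pc).
Proof.
  intros HX Hhyp HV HP (lam & c & r & Pc & Hlam & Hc & Hr & [Hpath Hend] & Hsup).
  destruct (hyperbolic_four_point G X Hhyp) as [D HD].
  destruct (INR_upper lam) as [L HL]. destruct (INR_upper c) as [C HC].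
  destruct (INR_upper r) as [r' Hr'].
  destruct (central_cone_exists G X HX D HD P HP L C r') as (z & Pz & Cz); auto.
  - intros y Py. destruct (Hend y Py) as (v & Hv & <-).
    destruct (Hpath v Hv) as (Hqg & H0 & _). destruct (Hqg) as [[Hnil Hadj] _].
    assert (Hlen : length v <> 0%nat) by now rewrite length_zero_iff_nil.
    (* [N] counts steps, one fewer than the vertices. *)
    exists (length v - 1)%nat, (fun i => nth i v gone).
    split; [exact H0|split; [now rewrite last_nth_pred|split; [|split]]].
    + intros i Hi. apply dX_adj, Hadj; auto. lia.
    + intros i j Hij. apply (quasi_geodesic_nat G X lam c); auto. lia.
    + intros i Hi. destruct (Hsup v Hv (nth i v gone)) as (g & Pg & Hg).
      { apply nth_In. lia. }
      exists g. split; auto. apply INR_le. lra.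
  - apply HV. exact (central_cone_virtually_cyclic G X HX D HD P HP z Pz Cz).
Qed.
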